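(* Fix a time $t$ and consider a junction with incoming roads $1,\ldots,n$ and outgoing roads $n+1,\ldots,n+m$. Let $u_{hj}^+(a_j)\le u_*$ for all $j\in\{n+1,\ldots,n+m\}$. Then the traffic distribution error satisfies $E_j=0$ for all $j\in\{n+1,\ldots,n+m\}$, for both the $\alpha$-inside and the $\alpha$-outside Godunov fluxes.
   Context: Junction: $n,m\ge 1$; each road $k\in\{1,\ldots,n+m\}$ is an interval $[a_k,b_k]$; roads $1,\ldots,n$ are incoming (the junction is at their right endpoint $b_i$) and roads $n+1,\ldots,n+m$ are outgoing (the junction is at their left endpoint $a_j$). The traffic distribution coefficients $\alpha_{j,i}$ ($i=1,\ldots,n$, $j=n+1,\ldots,n+m$) satisfy $0\le\alpha_{j,i}\le1$ and $\sum_{j=n+1}^{n+m}\alpha_{j,i}=1$ for every $i$. Discrete densities: $u_{hk}$ is the discrete (discontinuous Galerkin) density on road $k$, at each time a piecewise polynomial function on $[a_k,b_k]$ with respect to a finite partition of $[a_k,b_k]$. The time $t$ is fixed and omitted from the notation. $u_{hi}^-(b_i)$ is the left-sided limit of $u_{hi}$ at $b_i$ and $u_{hj}^+(a_j)$ is the right-sided limit of $u_{hj}$ at $a_j$. Flux: $f\in C^1(\mathbb{R})$ has a global maximum at $u_*$, is non-decreasing on $(-\infty,u_*]$ and non-increasing on $[u_*,\infty)$. Set $f_{in}(u^-)=f(u^-)$ if $u^-<u_*$ and $f_{in}(u^-)=f(u_* )$ if $u^-\ge u_*$; $f_{out}(u^+)=f(u_* )$ if $u^+\le u_*$ and $f_{out}(u^+)=f(u^+)$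 if $u^+>u_*$. Define $H(u^-,u^+)=\min\{f_{in}(u^-),f_{out}(u^+)\}$ and $H(u^-,u^+,\alpha)=\min\{\alpha f_{in}(u^-),f_{out}(u^+)\}$. Junction fluxes. $\alpha$-outside Godunov fluxes: $H_j=\sum_{i=1}^n\alpha_{j,i}H(u_{hi}^-(b_i),u_{hj}^+(a_j))$ for $j=n+1,\ldots,n+m$ and $H_i=\sum_{j=n+1}^{n+m}\alpha_{j,i}H(u_{hi}^-(b_i),u_{hj}^+(a_j))$ for $i=1,\ldots,n$. $\alpha$-inside Godunov fluxes: $H_j=\sum_{i=1}^n H(u_{hi}^-(b_i),u_{hj}^+(a_j),\alpha_{j,i})$ for $j=n+1,\ldots,n+m$ and $H_i=\sum_{j=n+1}^{n+m}H(u_{hi}^-(b_i),u_{hj}^+(a_j),\alpha_{j,i})$ for $i=1,\ldots,n$. Traffic distribution error (for either choice of junction fluxes): $E_j=H_j-\sum_{i=1}^n\alpha_{j,i}H_i$ for $j=n+1,\ldots,n+m$.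
   Formalization: For the α-inside fluxes the formal statement additionally assumes f(u_* ) ≥ 0 (true for traffic fluxes, where f(0)=0); without it the claim fails, e.g. f ≡ −1, u_*=0, n=1, m=2, α=(1,0), zero densities, giving E=1 on the first outgoing road. *)

(* Defs.v *)
From HB Require Import structures.
From mathcomp Require Import all_boot all_order all_algebra.
From mathcomp Require Import all_classical all_reals all_analysis.

Set Implicit Arguments.
Unset Strict Implicit.
Unset Printing Implicit Defensive.

Import Order.TTheory GRing.Theory Num.Theory.
Import numFieldNormedType.Exports.

Local Open Scope classical_set_scope.
Local Open Scope ring_scope.

(* The values of v at the nodes of the partition are left unconstrained, and
   the polynomial may change from cell to cell: v may be discontinuous there. *)
Definition piecewise_polynomial (R : realType) (a b : R) (v : R -> R) : Prop :=
  exists s : seq R, itv_partition a b s /\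
    forall k : nat, (k < size s)%N ->
      exists p : {poly R},
        forall x : R, nth b (a :: s) k < x < nth b (a :: s) k.+1 -> v x = p.[x].

(* [lim] is total; the limits exist for piecewise polynomial functions at the
   relevant endpoints, see [cvg_left_trace] and [cvg_right_trace]. *)
Definition left_trace (R : realType) (v : R -> R) (x0 : R) : R :=
  lim (v x @[x --> x0^'-]).

Definition right_trace (R : realType) (v : R -> R) (x0 : R) : R :=
  lim (v x @[x --> x0^'+]).

Lemma cvg_left_trace (R : realType) (a b : R) (v : R -> R) :
  a < b -> piecewise_polynomial a b v ->
  v x @[x --> b^'-] --> left_trace v b.
Proof.
move=> ab [s [[sp /eqP sb] vp]]; apply/cvg_ex => /=.
have s0 : (0 < size s)%N by case: s sb {sp vp} ab => //= ->; rewrite ltxx.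
have [p vpE] := vp (size s).-1 ltac:(by rewrite prednK).
exists p.[b].
have lastE : nth b (a :: s) (size s).-1.+1 = b.
  by rewrite prednK // -last_nth sb.
set c := nth b (a :: s) (size s).-1 in vpE.
have cb : c < b.
  rewrite -[ltRHS]lastE /c; move/(pathP b): sp => /(_ (size s).-1).
  by apply; rewrite prednK.
apply: (@cvg_trans _ (p.[x] @[x --> b^'-])).
  apply: near_eq_cvg; near=> x; apply/esym/vpE; rewrite lastE.
  by apply/andP; split; near: x; [exact: nbhs_left_gt|exact: nbhs_left_lt].
by apply: cvg_at_left_filter; exact: continuous_horner.
Unshelve. all: by end_near. Qed.

Lemma cvg_right_trace (R : realType) (a b : R) (v : R -> R) :
  a < b -> piecewise_polynomial a b v ->
  v x @[x --> a^'+] --> right_trace v a.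
Proof.
move=> ab [s [[sp /eqP sb] vp]]; apply/cvg_ex => /=.
have s0 : (0 < size s)%N by case: s sb {sp vp} ab => //= ->; rewrite ltxx.
have [p vpE] := vp 0%N s0; exists p.[a].
have ac : a < nth b (a :: s) 1.
  by move/(pathP b): sp => /(_ 0%N s0).
apply: (@cvg_trans _ (p.[x] @[x --> a^'+])).
  apply: near_eq_cvg; near=> x; apply/esym/vpE.
  by apply/andP; split; near: x; [exact: nbhs_right_gt|exact: nbhs_right_lt].
by apply: cvg_at_right_filter; exact: continuous_horner.
Unshelve. all: by end_near. Qed.

Definition C1 (R : realType) (f : R -> R) : Prop :=
  (forall x : R, derivable f x 1) /\ continuous (derive1 f).

Definition f_in (R : realType) (f : R -> R) (ustar u : R) : R :=
  if u < ustar then f u else f ustar.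

Definition f_out (R : realType) (f : R -> R) (ustar u : R) : R :=
  if u <= ustar then f ustar else f u.

Definition godunov (R : realType) (f : R -> R) (ustar um up : R) : R :=
  Num.min (f_in f ustar um) (f_out f ustar up).

Definition godunov_alpha (R : realType) (f : R -> R) (ustar um up alpha : R) : R :=
  Num.min (alpha * f_in f ustar um) (f_out f ustar up).

(* Junction fluxes, as functions of the traces um of the n incoming densities
   and up of the m outgoing ones.  The entry alpha j i is the share of the
   traffic of incoming road i that goes to outgoing road j. *)
Definition Hout_outside (R : realType) (n m : nat) (f : R -> R) (ustar : R)
    (alpha : 'M[R]_(m, n)) (um : 'I_n -> R) (up : 'I_m -> R) (j : 'I_m) : R :=
  \sum_(i < n) alpha j i * godunov f ustar (um i) (up j).

Definition Hin_outside (R : realType) (n m : nat) (f : R -> R) (ustar : R)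
    (alpha : 'M[R]_(m, n)) (um : 'I_n -> R) (up : 'I_m -> R) (i : 'I_n) : R :=
  \sum_(j < m) alpha j i * godunov f ustar (um i) (up j).

Definition Hout_inside (R : realType) (n m : nat) (f : R -> R) (ustar : R)
    (alpha : 'M[R]_(m, n)) (um : 'I_n -> R) (up : 'I_m -> R) (j : 'I_m) : R :=
  \sum_(i < n) godunov_alpha f ustar (um i) (up j) (alpha j i).

Definition Hin_inside (R : realType) (n m : nat) (f : R -> R) (ustar : R)
    (alpha : 'M[R]_(m, n)) (um : 'I_n -> R) (up : 'I_m -> R) (i : 'I_n) : R :=
  \sum_(j < m) godunov_alpha f ustar (um i) (up j) (alpha j i).

Definition distribution_error (R : realType) (n m : nat) (alpha : 'M[R]_(m, n))
    (Hout : 'I_m -> R) (Hin : 'I_n -> R) (j : 'I_m) : R :=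
  Hout j - \sum_(i < n) alpha j i * Hin i.

(* Main.v *)
(* When the outgoing roads do not restrict the flow, the flux from road i to
   road j is alpha j i * f_in (u_i), i.e. exactly the prescribed share of the
   demand of road i; summing over j returns the whole demand. *)

Require Import Defs.
From HB Require Import structures.
From mathcomp Require Import all_boot all_order all_algebra.
From mathcomp Require Import all_classical all_reals all_analysis.
Import Order.TTheory GRing.Theory Num.Theory.
Import numFieldNormedType.Exports.
Local Open Scope classical_set_scope.
Local Open Scope ring_scope.

Lemma f_in_le_max (R : realType) (f : R -> R) (ustar u : R) :
  (forall v : R, f v <= f ustar) -> f_in f ustar u <= f ustar.
Proof. by move=> fmax; rewrite /f_in; case: ifP. Qed.

(** For [up <= ustar] the supply [f_out] is the global maximum [f ustar], which no demand [f_in]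
    exceeds. *)
Lemma godunov_free_outflow (R : realType) (f : R -> R) (ustar um up : R) :
  (forall v : R, f v <= f ustar) -> up <= ustar ->
  godunov f ustar um up = f_in f ustar um.
Proof.
by move=> fmax upu; rewrite /godunov /f_out upu min_l // f_in_le_max.
Qed.

(** The chain is [alpha * f_in <= alpha * f ustar <= f ustar]; its second step uses the sign of
    [f ustar]. If [f ustar < 0] and [alpha = 0], the minimum would be [f ustar] instead of [0]. *)
Lemma godunov_alpha_free_outflow (R : realType) (f : R -> R)
    (ustar um up alpha : R) :
  (forall v : R, f v <= f ustar) -> 0 <= f ustar -> up <= ustar ->
  0 <= alpha <= 1 ->
  godunov_alpha f ustar um up alpha = alpha * f_in f ustar um.
Proof.
move=> fmax f0 upu /andP[a0 a1]; rewrite /godunov_alpha /f_out upu min_l //.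
by apply: (le_trans (ler_wpM2l a0 (f_in_le_max R f ustar um fmax))); exact: ler_piMl.
Qed.

(** Since each column of [alpha] sums to 1, [Hin i] collapses to [q i], so the two terms of the
    error agree. Keeping [q] abstract lets one argument serve both flux choices. *)
Lemma distribution_error_proportional (R : realType) (n m : nat)
    (alpha : 'M[R]_(m, n)) (q : 'I_n -> R) (Hout : 'I_m -> R)
    (Hin : 'I_n -> R) (j : 'I_m) :
  (forall i, \sum_(k < m) alpha k i = 1) ->
  (forall k, Hout k = \sum_(i < n) alpha k i * q i) ->
  (forall i, Hin i = \sum_(k < m) alpha k i * q i) ->
  distribution_error alpha Hout Hin j = 0.
Proof.
move=> alpha1 HoutE HinE; apply/eqP; rewrite subr_eq0 HoutE; apply/eqP.
by apply: eq_bigr => i _; rewrite HinE -mulr_suml alpha1 mul1r.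
Qed.

(* Road k : 'I_(n + m); lshift m i is incoming road i, rshift n j is outgoing
   road j.  uh k t x is the discrete density on road k at time t and point x. *)
Theorem theorem1 (R : realType) (n m : nat) (hn : (1 <= n)%N) (hm : (1 <= m)%N)
  (a b : 'I_(n + m) -> R) (hab : forall k, a k < b k)
  (alpha : 'M[R]_(m, n))
  (halpha01 : forall j i, 0 <= alpha j i <= 1)
  (halpha1 : forall i : 'I_n, \sum_(j < m) alpha j i = 1)
  (f : R -> R) (ustar : R)
  (hC1 : C1 f)
  (hmax : forall u : R, f u <= f ustar)
  (hincr : forall u v : R, u <= v -> v <= ustar -> f u <= f v)
  (hdecr : forall u v : R, ustar <= u -> u <= v -> f v <= f u)
  (uh : 'I_(n + m) -> R -> R -> R) (t : R)
  (huh : forall k, piecewise_polynomial (a k) (b k) (uh k t)) :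
  let um := fun i : 'I_n => left_trace (uh (lshift m i) t) (b (lshift m i)) in
  let up := fun j : 'I_m => right_trace (uh (rshift n j) t) (a (rshift n j)) in
  (forall j : 'I_m, up j <= ustar) ->
  (forall j : 'I_m,
     distribution_error alpha (Hout_outside f ustar alpha um up)
       (Hin_outside f ustar alpha um up) j = 0) /\
  (0 <= f ustar ->
   forall j : 'I_m,
     distribution_error alpha (Hout_inside f ustar alpha um up)
       (Hin_inside f ustar alpha um up) j = 0).
Proof.
move=> um up upu; split=> [j|f0 j].
(* Both flux choices share the same [q]: the demand [f_in] at the incoming traces. *)
- apply: (distribution_error_proportional _ _ _ _ (f_in f ustar \o um)) => // k;
  by apply: eq_bigr => l _; rewrite godunov_free_outflow.
- apply: (distribution_error_proportional _ _ _ _ (f_in f ustar \o um)) => // k;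
  by apply: eq_bigr => l _; rewrite godunov_alpha_free_outflow.
Qed.
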